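(* Let $q,\beta>0$ and $n\in\mathbb{N}$. For every $f\in C_B(\mathbb{R})\cup C_U(\mathbb{R})$, $$\omega(B_n(f),\theta)\le\omega(f,\theta)\quad\text{for all }\theta>0.$$ Furthermore, if $f\in C_U(\mathbb{R})$ then $B_n(f)\in C_U(\mathbb{R})$.
   Context: $\mathbb{N}=\{1,2,\dots\}$. For $q,\beta>0$ and $x\in\mathbb{R}$ let $\nu_{q}(x)=\frac{1-qe^{-\beta x}}{1+qe^{-\beta x}}$ and $G_{q,\beta}(x)=\frac14\left(\nu_{q}(x+1)-\nu_{q}(x-1)\right)$; $G_{1/q,\beta}$ is the same with $q$ replaced by $1/q$. Let $\Psi=\frac12\left(G_{q,\beta}+G_{1/q,\beta}\right)$ (an even probability density on $\mathbb{R}$). $C_B(\mathbb{R})$ is the set of continuous bounded real functions on $\mathbb{R}$; $C_U(\mathbb{R})$ is the set of uniformly continuous (not necessarily bounded) real functions on $\mathbb{R}$. For $\theta>0$, $\omega(f,\theta)=\sup\{|f(x)-f(y)|: x,y\in\mathbb{R},\ |x-y|\le\theta\}$. The operator $B_n$ is $$B_n(f)(x)=\int_{-\infty}^{\infty}f\left(\frac vn\right)\Psi(nx-v)\,dv .$$ *)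

(* Defs.v *)
From HB Require Import structures.
From mathcomp Require Import all_boot all_order all_algebra.
From mathcomp Require Import all_classical all_reals all_analysis.

Set Implicit Arguments.
Unset Strict Implicit.
Unset Printing Implicit Defensive.

Import Order.TTheory GRing.Theory Num.Theory.
Import numFieldNormedType.Exports.

Local Open Scope classical_set_scope.
Local Open Scope ring_scope.

Definition nu (R : realType) (q beta : R) (x : R) : R :=
  (1 - q * expR (- (beta * x))) / (1 + q * expR (- (beta * x))).

Definition G (R : realType) (q beta : R) (x : R) : R :=
  4^-1 * (nu q beta (x + 1) - nu q beta (x - 1)).

Definition Psi (R : realType) (q beta : R) (x : R) : R :=
  2^-1 * (G q beta x + G q^-1 beta x).

(* The integral is the real-valued Lebesgue integral over the whole line, which
   is the intended (absolutely convergent) integral when f is continuous and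
   bounded or uniformly continuous: such an f grows at most linearly and
   [Psi q beta] decays exponentially. *)
Definition B (R : realType) (q beta : R) (n : nat) (f : R -> R) (x : R) : R :=
  \int[@lebesgue_measure R]_v (f (v / n%:R) * Psi q beta (n%:R * x - v)).

Definition C_B (R : realType) : set (R -> R) :=
  [set f | continuous f /\ bounded_fun f].

Definition C_U (R : realType) : set (R -> R) :=
  [set f | unif_continuous f].

Arguments C_B R : clear implicits.
Arguments C_U R : clear implicits.

(* The supremum is taken in the extended reals, so that an unbounded oscillation
   gives +oo instead of the default value of the real-valued supremum. *)
Definition omega (R : realType) (f : R -> R) (theta : R) : \bar R :=
  ereal_sup [set `|f p.1 - f p.2|%:E | p in [set p : R * R | `|p.1 - p.2| <= theta]].

(* Main.v *)
(* Psi is an even probability density, so translating the Lebesgue integral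
   gives B_n f(x) = int f(v/n + x) Psi(v) dv, hence
   |B_n f(x) - B_n f(y)| <= int |f(v/n + x) - f(v/n + y)| Psi(v) dv
                         <= omega(f, |x - y|).
   The integrals converge because f grows at most linearly whereas
   Psi(v) = O(exp(-beta |v|)).  That Psi has total mass 1 comes from the
   primitive x + (2/beta) ln(1 + q exp(-beta x)) of nu_q. *)
Require Import Defs.
From HB Require Import structures.
From mathcomp Require Import all_boot all_order all_algebra.
From mathcomp Require Import all_classical all_reals all_analysis.
From mathcomp Require Import measurable_realfun ring lra.

Set Implicit Arguments.
Unset Strict Implicit.
Unset Printing Implicit Defensive.

Import Order.TTheory GRing.Theory Num.Theory.
Import numFieldNormedType.Exports.

Local Open Scope classical_set_scope.
Local Open Scope ring_scope.

(** * Monotonicity, bounds and reflection of [nu] *)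

Lemma nu_den_gt0 (R : realType) (q beta x : R) : 0 < q ->
  0 < 1 + q * expR (- (beta * x)).
Proof. by move=> q0; rewrite addr_gt0// mulr_gt0// expR_gt0. Qed.

(** Here x occurs only once, in the denominator, so monotonicity, decay and the derivative can be
    read off. *)
Lemma nuE (R : realType) (q beta x : R) : 0 < q ->
  nu q beta x = 2 / (1 + q * expR (- (beta * x))) - 1.
Proof.
move=> q0; have := nu_den_gt0 beta x q0.
by rewrite /nu => /lt0r_neq0 d0; field.
Qed.

Lemma nu_le (R : realType) (q beta x y : R) : 0 < q -> 0 < beta -> x <= y ->
  nu q beta x <= nu q beta y.
Proof.
move=> q0 b0 xy; rewrite !nuE// lerB// ler_pM2l// lef_pV2 ?posrE ?nu_den_gt0//.
by rewrite lerD2l ler_pM2l// ler_expR lerN2 ler_pM2l.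
Qed.

Lemma nu_le1 (R : realType) (q beta x : R) : 0 < q -> nu q beta x <= 1.
Proof.
move=> q0; rewrite /nu ler_pdivrMr ?nu_den_gt0// mul1r.
have : 0 < q * expR (- (beta * x)) by rewrite mulr_gt0// expR_gt0.
by move=> ?; lra.
Qed.

Lemma onem_nu_le (R : realType) (q beta x : R) : 0 < q ->
  1 - nu q beta x <= 2 * q * expR (- (beta * x)).
Proof.
move=> q0; have d0 := nu_den_gt0 beta x q0.
have e0 : 0 < q * expR (- (beta * x)) by rewrite mulr_gt0// expR_gt0.
rewrite nuE//; set e := _ * _ in e0 d0 *.
have -> : 1 - (2 / (1 + e) - 1) = 2 * e / (1 + e) by field; exact: lt0r_neq0.
by rewrite ler_pdivrMr// -mulrA -/e; nra.
Qed.

(** Multiply numerator and denominator by q exp(beta x). This reflection is what makes [Psi]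
    even. *)
Lemma nuV (R : realType) (q beta x : R) : 0 < q ->
  nu q^-1 beta x = - nu q beta (- x).
Proof.
move=> q0; rewrite /nu mulrN opprK expRN.
have := expR_gt0 (beta * x); set e := expR _ => e0.
by field; rewrite !gt_eqF// ?addr_gt0// mulr_gt0.
Qed.

Lemma continuous_nu (R : realType) (q beta : R) : 0 < q ->
  continuous (nu q beta).
Proof.
move=> q0 x; apply: cvgM.
  apply: cvgB; first exact: cvg_cst.
  apply: cvgM; first exact: cvg_cst.
  apply: continuous_cvg; first exact: continuous_expR.
  by apply: cvgN; apply: cvgM; [exact: cvg_cst|exact: cvg_id].
apply: cvgV; first by rewrite lt0r_neq0// nu_den_gt0.
apply: cvgD; first exact: cvg_cst.
apply: cvgM; first exact: cvg_cst.
apply: continuous_cvg; first exact: continuous_expR.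
by apply: cvgN; apply: cvgM; [exact: cvg_cst|exact: cvg_id].
Qed.

(** * Positivity, evenness and exponential decay of the kernel *)

Lemma G_ge0 (R : realType) (q beta x : R) : 0 < q -> 0 < beta ->
  0 <= G q beta x.
Proof.
move=> q0 b0; rewrite /G mulr_ge0// subr_ge0 nu_le//; lra.
Qed.

Lemma GV (R : realType) (q beta x : R) : 0 < q ->
  G q^-1 beta x = G q beta (- x).
Proof.
move=> q0; rewrite /G !nuV// opprD opprB opprK.
by rewrite (addrC 1) [- nu _ _ _ + _]addrC.
Qed.

Lemma continuous_G (R : realType) (q beta : R) : 0 < q ->
  continuous (G q beta).
Proof.
move=> q0 x; apply: cvgM; first exact: cvg_cst.
by apply: cvgB; apply: continuous_cvg; do ?[exact: continuous_nu];
  [apply: cvgD|apply: cvgB]; do ?[exact: cvg_id]; exact: cvg_cst.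
Qed.

(** Bound nu(x + 1) by 1 and apply [onem_nu_le] at x - 1, which produces the factor exp(beta). The
    bound expresses decay only towards +oo; evenness of [Psi] supplies the other side. *)
Lemma G_le (R : realType) (q beta x : R) : 0 < q ->
  G q beta x <= 2^-1 * q * expR beta * expR (- (beta * x)).
Proof.
move=> q0; rewrite /G.
have := nu_le1 beta (x + 1) q0; have := onem_nu_le beta (x - 1) q0.
rewrite mulrBr mulr1 opprB expRD -mulrA => h1 h2.
by rewrite -!mulrA; lra.
Qed.

Lemma Psi_ge0 (R : realType) (q beta x : R) : 0 < q -> 0 < beta ->
  0 <= Psi q beta x.
Proof.
by move=> q0 b0; rewrite /Psi mulr_ge0// addr_ge0// G_ge0// invr_gt0.
Qed.

Lemma PsiN (R : realType) (q beta x : R) : 0 < q ->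
  Psi q beta (- x) = Psi q beta x.
Proof. by move=> q0; rewrite /Psi !GV// opprK addrC. Qed.

Lemma continuous_Psi (R : realType) (q beta : R) : 0 < q ->
  continuous (Psi q beta).
Proof.
move=> q0 x; apply: cvgM; first exact: cvg_cst.
by apply: cvgD; apply: continuous_G; rewrite ?invr_gt0.
Qed.

Lemma Psi_le (R : realType) (q beta x : R) : 0 < q ->
  Psi q beta x <= 4^-1 * (q + q^-1) * expR beta * expR (- (beta * `|x|)).
Proof.
move=> q0; wlog x0 : x / 0 <= x => [h|].
  by case: (leP 0 x) => [/h//|/ltW x0]; rewrite -PsiN// -normrN h// oppr_ge0.
have q'0 : 0 < q^-1 by rewrite invr_gt0.
rewrite ger0_norm// /Psi.
have := G_le beta x q0; have := G_le beta x q'0; rewrite -!mulrA => h1 h2.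
by rewrite mulrDl mulrDr; lra.
Qed.

(** * Total mass of [Psi] *)

Definition nu_primitive (R : realType) (q beta x : R) : R :=
  x + 2 / beta * ln (1 + q * expR (- (beta * x))).

(** The shift [c] is built in because the primitive of [Psi] combines the arguments x + 1 and x -
    1. *)
Lemma is_derive_nu_primitive (R : realType) (q beta c x : R) :
  0 < q -> 0 < beta ->
  is_derive x 1 (fun y => nu_primitive q beta (y + c)) (nu q beta (x + c)).
Proof.
move=> q0 b0; have d0 := nu_den_gt0 beta (x + c) q0.
have dlin : is_derive x 1 (fun y : R => - (beta * (y + c))) (- beta).
  by apply: is_derive_eq; rewrite /GRing.scale /=; ring.
have dexp : is_derive x 1 (fun y => 1 + q * expR (- (beta * (y + c))))
    (- (q * beta * expR (- (beta * (x + c))))).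
  have dE := @is_derive1_comp _ expR (fun y => - (beta * (y + c))) x _ _
    (is_derive_expR _) dlin.
  by apply: is_derive_eq; rewrite /GRing.scale /=; ring.
have dln := @is_derive1_comp _ (@ln R) _ x _ _ (is_derive1_ln d0) dexp.
apply: is_derive_eq; rewrite nuE// /GRing.scale /=.
by field; rewrite !gt_eqF.
Qed.

(* Makes the primitive of Psi vanish at 0. *)
Lemma nu_primitiveN (R : realType) (q beta x : R) : 0 < q -> 0 < beta ->
  nu_primitive q beta (- x) = nu_primitive q^-1 beta x + 2 / beta * ln q.
Proof.
move=> q0 b0; rewrite /nu_primitive mulrN opprK.
(* The logarithm of the extracted factor is ln q + beta x; times 2 / beta this gives 2x, which turns
   -x into x. *)
have -> : 1 + q * expR (beta * x) =
    q * expR (beta * x) * (1 + q^-1 * expR (- (beta * x))).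
  by rewrite expRN; field; rewrite !gt_eqF// expR_gt0.
rewrite !lnM ?posrE ?mulr_gt0 ?nu_den_gt0 ?invr_gt0 ?expR_gt0// expRK.
by field; rewrite gt_eqF.
Qed.

(** Subtracting x removes the linear growth, and the logarithm tends to ln 1 = 0. Differences of
    shifted primitives thus have finite limits. *)
Lemma cvg_nu_primitive (R : realType) (q beta c : R) : 0 < q -> 0 < beta ->
  nu_primitive q beta (x + c) - x @[x --> +oo] --> c.
Proof.
move=> q0 b0.
have h : 1 + q * expR (- (beta * c)) * expR (- (beta * x)) @[x --> +oo] -->
    1 + q * expR (- (beta * c)) * 0.
  apply: cvgD; first exact: cvg_cst.
  apply: cvgM; first exact: cvg_cst.
  apply: (@cvg_comp _ _ _ (fun x => beta * x) (fun y => expR (- y)) _ (+oo%R)).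
    exact: gt0_cvgMry.
  exact: cvgr_expR.
rewrite mulr0 addr0 in h.
have {}h : ln (1 + q * expR (- (beta * c)) * expR (- (beta * x)))
    @[x --> +oo] --> 0.
  rewrite -(@ln1 R); apply: continuous_cvg h.
  exact: continuous_ln.
have {}h : c + 2 / beta * ln (1 + q * expR (- (beta * c)) * expR (- (beta * x)))
    @[x --> +oo] --> c + 2 / beta * 0.
  apply: cvgD; first exact: cvg_cst.
  by apply: cvgM; [exact: cvg_cst|exact: h].
rewrite mulr0 addr0 in h.
apply: cvg_trans h; apply: near_eq_cvg; near=> x.
by rewrite /nu_primitive mulrDr opprD expRD [expR _ * expR _]mulrC mulrA; ring.
Unshelve. all: by end_near. Qed.

Lemma integral_Psi (R : realType) (q beta : R) : 0 < q -> 0 < beta ->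
  (\int[@lebesgue_measure R]_x (Psi q beta x)%:E = 1)%E.
Proof.
move=> q0 b0; have q'0 : 0 < q^-1 by rewrite invr_gt0.
rewrite ge0_symfun_integralT//; last 3 first.
  by move=> x; exact: Psi_ge0.
  exact: continuous_Psi.
  by move=> x /=; rewrite PsiN.
(* The factor 1/8 combines the 1/2 of [Psi] with the 1/4 of [G]. *)
pose F x := 8^-1 * (nu_primitive q beta (x + 1) - nu_primitive q beta (x + -1)
  + (nu_primitive q^-1 beta (x + 1) - nu_primitive q^-1 beta (x + -1))).
have dF (x : R) : is_derive x 1 F (Psi q beta x).
  have d1 c := is_derive_nu_primitive c x q0 b0.
  have d2 c := is_derive_nu_primitive c x q'0 b0.
  by apply: is_derive_eq; rewrite /Psi /G /GRing.scale /=; field.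
(* Reflection turns the [q] difference into the opposite of the [q^-1] difference; the constants
   involving ln q cancel. *)
have F0 : F 0 = 0.
  rewrite /F !add0r; have := nu_primitiveN 1 q0 b0.
  have := nu_primitiveN (-1) q0 b0; rewrite opprK => -> ->; ring.
(* Both differences in [F] tend to 2, so [F] tends to 4/8 and each half line carries mass 1/2. *)
rewrite -set_itvcy (@ge0_continuous_FTC2y _ _ F 0 2^-1).
- by rewrite F0 sube0 -EFinM divff.
- by move=> x _; exact: Psi_ge0.
- exact/continuous_subspaceT/continuous_Psi.
- have h1 c := @cvg_nu_primitive R q beta c q0 b0.
  have h2 c := @cvg_nu_primitive R q^-1 beta c q'0 b0.
  have -> : F = fun x => 8^-1 *
      ((nu_primitive q beta (x + 1) - x) - (nu_primitive q beta (x + -1) - x) +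
      ((nu_primitive q^-1 beta (x + 1) - x) -
       (nu_primitive q^-1 beta (x + -1) - x))).
    by apply/funext => x; rewrite /F; ring.
  have -> : 2^-1 = 8^-1 * (1 - -1 + (1 - -1)) :> R by field.
  by apply: cvgM; [exact: cvg_cst|apply: cvgD; apply: cvgB].
- by move=> x _; case: (dF x).
- apply: cvg_at_right_filter; apply: differentiable_continuous.
  by apply/derivable1_diffP; case: (dF 0).
- by move=> x _; rewrite derive1E; case: (dF x).
Qed.

(** * An integrable exponential majorant *)

Lemma integrable_expR_abs (R : realType) (a : R) : 0 < a ->
  (@lebesgue_measure R).-integrable setT (fun x => (expR (- (a * `|x|)))%:E).
Proof.
move=> a0.
have cf : continuous (fun x : R => expR (- (a * `|x|))).
  move=> x; apply: continuous_cvg; first exact: continuous_expR.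
  by apply: cvgN; apply: cvgM; [exact: cvg_cst|exact: norm_continuous].
apply/integrableP; split.
  by apply/measurable_EFinP; exact: continuous_measurable_fun.
under eq_integral do rewrite /= ger0_norm ?expR_ge0//.
rewrite ge0_symfun_integralT//=; last by move=> x /=; rewrite normrN.
rewrite -set_itvcy.
under eq_integral => x do
  [rewrite inE/= in_itv/= andbT => x0; rewrite (ger0_norm x0)].
pose F x := - a^-1 * expR (- (a * x)).
have dF (x : R) : is_derive x 1 F (expR (- (a * x))).
  have dlin : is_derive x 1 (fun y : R => - (a * y)) (- a).
    by apply: is_derive_eq; rewrite /GRing.scale /=; ring.
  have dE := @is_derive1_comp _ expR _ x _ _ (is_derive_expR _) dlin.
  by apply: is_derive_eq; rewrite /GRing.scale /=; field; rewrite gt_eqF.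
rewrite (@ge0_continuous_FTC2y _ _ F 0 0).
- by rewrite /F mulr0 oppr0 expR0 mulr1 sub0e -EFinN -EFinM ltry.
- by move=> x _; exact: expR_ge0.
- apply: continuous_subspaceT => x.
  apply: continuous_cvg; first exact: continuous_expR.
  by apply: cvgN; apply: cvgM; [exact: cvg_cst|exact: cvg_id].
- rewrite -(mulr0 (- a^-1)); apply: cvgM; first exact: cvg_cst.
  apply: (@cvg_comp _ _ _ (fun x => a * x) (fun y => expR (- y)) _ (+oo%R)).
    exact: gt0_cvgMry.
  exact: cvgr_expR.
- by move=> x _; case: (dF x).
- apply: cvg_at_right_filter; apply: differentiable_continuous.
  by apply/derivable1_diffP; case: (dF 0).
- by move=> x _; rewrite derive1E; case: (dF x).
Qed.

(** * Translation invariance of the Lebesgue integral *)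

(** By uniqueness of Lebesgue measure it is enough to compare the two measures on half-open
    intervals. *)
Lemma lebesgue_measure_shift (R : realType) (c : R) (A : set R) :
  measurable A ->
  pushforward (@lebesgue_measure R)
    ((fun x => x + c) : _ -> measurableTypeR R) A = lebesgue_measure A.
Proof.
pose shift_c := (fun x => x + c) : measurableTypeR R -> measurableTypeR R.
have mshift : measurable_fun setT shift_c by exact: measurable_funD.
pose shift_mixin := isMeasurableFun.Build _ _ _ _ _ mshift.
(* Bundled as a measurable function, the shift has a pushforward that is recognised as a measure. *)
pose shift_mfun : {mfun _ >-> _} := HB.pack shift_c shift_mixin.
move=> mA; apply/esym.
apply: (@lebesgue_measure_unique _ (pushforward lebesgue_measure shift_mfun))
  => //= _ [[a b]] _ <-.
rewrite /pushforward.
have -> : shift_c @^-1` `]a, b] = `](a - c), (b - c)]%classic.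
  apply/seteqP; split => x /=;
    by rewrite /shift_c !in_itv/= ltrBlDr lerBrDr.
rewrite !lebesgue_measure_itv/= !lte_fin ltrD2r; case: ifP => // _.
by rewrite -!EFinB; congr (_%:E); ring.
Qed.

(** Change of variables for nonnegative functions, applied separately to the positive and negative
    parts. *)
Lemma Rintegral_shift (R : realType) (c : R) (f : R -> R) :
  measurable_fun setT f ->
  \int[@lebesgue_measure R]_x f (x + c) = \int[@lebesgue_measure R]_x f x.
Proof.
move=> mf; rewrite /Rintegral; congr fine.
have mshift : measurable_fun setT
    ((fun x => x + c) : measurableTypeR R -> measurableTypeR R).
  exact: measurable_funD.
have ge0_shift (g : R -> \bar R) : measurable_fun setT g ->
    (forall x, 0 <= g x)%E ->
    (\int[@lebesgue_measure R]_x g (x + c)%R =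
     \int[@lebesgue_measure R]_x g x)%E.
  move=> mg g0.
  have := @ge0_integral_pushforward _ _ _ _ _ _ mshift lebesgue_measure
    setT g measurableT mg (fun y _ => g0 y).
  rewrite preimage_setT => <-.
  by apply: eq_measure_integral => A mA _; exact: lebesgue_measure_shift.
have mEf : measurable_fun setT (EFin \o f) by apply/measurable_EFinP.
rewrite integralE [RHS]integralE; congr (_ - _)%E.
  rewrite -(ge0_shift _ (measurable_funepos mEf) (fun x => funepos_ge0 _ x)).
  by apply: eq_integral => x _; rewrite !funeposE.
rewrite -(ge0_shift _ (measurable_funeneg mEf) (fun x => funeneg_ge0 _ x)).
by apply: eq_integral => x _; rewrite !funenegE.
Qed.

(** * Convergence of the integral defining [B] and its oscillation *)

(** Replacing v by v + n x makes the kernel Psi(-v) = Psi(v), so the values of [B] at different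
    points share one kernel. *)
Lemma B_shift (R : realType) (q beta : R) (n : nat) (f : R -> R) (x : R) :
  0 < q -> (0 < n)%N -> continuous f ->
  B q beta n f x =
  \int[@lebesgue_measure R]_v (f (v / n%:R + x) * Psi q beta v).
Proof.
move=> q0 n0 cf; rewrite /B -(Rintegral_shift (n%:R * x)).
  apply: eq_Rintegral => v _.
  rewrite -(PsiN _ v)//; congr (f _ * Psi _ _ _); last by ring.
  by field; rewrite pnatr_eq0 -lt0n.
apply: measurable_funM.
  apply: (measurableT_comp (continuous_measurable_fun cf)).
  exact: measurable_funM.
apply: (measurableT_comp (continuous_measurable_fun (continuous_Psi q0))).
exact: measurable_funB.
Qed.

Lemma integrable_linear_growth_Psi (R : realType) (q beta : R) (n : nat)
    (f : R -> R) (a c x : R) :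
  0 < q -> 0 < beta -> (0 < n)%N -> continuous f -> 0 <= a -> 0 <= c ->
  (forall y, `|f y| <= a + c * `|y|) ->
  (@lebesgue_measure R).-integrable setT
    (fun v => (f (v / n%:R + x) * Psi q beta v)%:E).
Proof.
move=> q0 b0 n0 cf a0 c0 fac.
pose k := 4^-1 * (q + q^-1) * expR beta.
have k0 : 0 <= k.
  by rewrite /k !mulr_ge0 ?expR_ge0// addr_ge0// ?invr_ge0 ltW.
(* Half of the exponential decay absorbs the linear growth: |v| exp(-beta |v| / 2) is at most 2 /
   beta. The other half stays as the integrable majorant. *)
pose m := k * (a + c * `|x| + c * (2 / beta)).
have b20 : 0 < beta / 2 by rewrite divr_gt0.
have hi := integrableZl measurableT m (integrable_expR_abs b20).
apply: le_integrable hi => //.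
  apply/measurable_EFinP; apply: measurable_funM.
    apply: (measurableT_comp (continuous_measurable_fun cf)).
    by apply: measurable_funD => //; exact: measurable_funM.
  by apply: continuous_measurable_fun; exact: continuous_Psi.
move=> v _ /=; rewrite lee_fin; apply: le_trans (ler_norm _).
rewrite normrM (ger0_norm (Psi_ge0 v q0 b0)).
have fv : `|f (v / n%:R + x)| <= a + c * (`|v| + `|x|).
  apply: le_trans (fac _) _; rewrite lerD2l ler_wpM2l//.
  apply: le_trans (ler_normD _ _) _; rewrite lerD2r normrM ler_piMr//.
  by rewrite normfV normr_nat invf_le1 ?ltr0n// ler1n.
apply: le_trans (ler_pM _ _ fv (Psi_le beta v q0)) _ => //.
  exact: Psi_ge0.
rewrite -/k; set s := expR (- (beta / 2 * `|v|)).
have s0 : 0 < s by exact: expR_gt0.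
have -> : expR (- (beta * `|v|)) = s * s by rewrite -expRD; congr expR; field.
have s1 : s <= 1.
  by rewrite -expR0 ler_expR oppr_le0 mulr_ge0// ltW.
(* This is t <= exp(t) for t = beta |v| / 2, obtained from 1 + t <= exp(t). *)
have vs : `|v| * s <= 2 / beta.
  rewrite /s expRN ler_pdivrMr ?expR_gt0//.
  have := expR_ge1Dx (beta / 2 * `|v|); set e := expR _ => h.
  have -> : `|v| = 2 / beta * (beta / 2 * `|v|) by field; rewrite gt_eqF.
  by rewrite ler_pM2l ?divr_gt0//; lra.
rewrite /m -[leRHS]mulrA mulrCA ler_wpM2l// mulrA ler_wpM2r ?(ltW s0)//.
have acx : (a + c * `|x|) * s <= a + c * `|x|.
  by rewrite ler_piMr// addr_ge0// mulr_ge0.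
have := ler_wpM2l c0 vs; lra.
Qed.

Lemma Rintegral_Psi (R : realType) (q beta : R) : 0 < q -> 0 < beta ->
  \int[@lebesgue_measure R]_x (Psi q beta x) = 1.
Proof. by move=> q0 b0; rewrite /Rintegral integral_Psi. Qed.

(** A common core for both claims: [w] becomes the modulus of [f] in the first and e / 2 in the
    second. Linear growth covers both function classes. *)
Lemma B_oscillation_le (R : realType) (q beta : R) (n : nat)
    (f : R -> R) (a c w theta : R) :
  0 < q -> 0 < beta -> (0 < n)%N -> continuous f -> 0 <= a -> 0 <= c ->
  (forall y, `|f y| <= a + c * `|y|) ->
  (forall x y, `|x - y| <= theta -> `|f x - f y| <= w) ->
  forall x y, `|x - y| <= theta -> `|B q beta n f x - B q beta n f y| <= w.
Proof.
move=> q0 b0 n0 cf a0 c0 fac fw x y xy; rewrite !B_shift//.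
have ix z := integrable_linear_growth_Psi z q0 b0 n0 cf a0 c0 fac.
have iP : (@lebesgue_measure R).-integrable setT (EFin \o Psi q beta).
  apply/integrableP; split.
    apply/measurable_EFinP; apply: continuous_measurable_fun.
    exact: continuous_Psi.
  under eq_integral do rewrite /= ger0_norm ?Psi_ge0//.
  by rewrite integral_Psi// ltry.
have iB := integrableB measurableT (ix x) (ix y).
rewrite -RintegralB//; [|exact: ix|exact: ix].
apply: le_trans (le_normr_Rintegral _ _) _ => //.
(* Since [Psi] has mass 1, [w] is the integral of w Psi, and the integrands can be compared
   pointwise. *)
rewrite -[leRHS]mulr1 -[X in w * X](Rintegral_Psi q0 b0) -RintegralZl//.
apply: le_Rintegral => //.
- exact: (integrable_norm iB).
- exact: (integrableZl measurableT w iP).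
- move=> v _; rewrite -mulrBl normrM (ger0_norm (Psi_ge0 v q0 b0)).
  rewrite ler_wpM2r ?Psi_ge0//; apply: fw.
  by rewrite opprD addrACA subrr add0r.
Qed.

(** * Linear growth of uniformly continuous functions *)

Lemma unif_continuous_linear_growth (R : realType) (f : R -> R) :
  unif_continuous f ->
  exists2 c, 0 <= c & forall y, `|f y| <= (`|f 0| + 1) + c * `|y|.
Proof.
move=> /unif_continuousP/(_ 1 ltr01)[d d0 fd].
(* Halving [d] lets steps satisfy a non-strict bound although the ball is open. *)
pose e := d / 2.
have e0 : 0 < e by rewrite divr_gt0.
(* Go from y to 0 through multiples of y, in k + 1 steps of length <= e. *)
have step x y : `|x - y| <= e -> `|f x - f y| <= 1.
  move=> xy; apply/ltW/(fd (x, y)) => /=; rewrite /ball/=.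
  by apply: le_lt_trans xy _; rewrite /e; lra.
have bound k y : `|y| <= k%:R * e -> `|f y| <= `|f 0| + k%:R.
  elim: k y => [|k IH] y; first by rewrite mul0r addr0 normr_le0 => /eqP ->.
  move=> yk.
  (* The intermediate point is y k / (k + 1), at distance |y| / (k + 1) <= e from y. *)
  have k0 : 0 < k.+1%:R :> R by rewrite ltr0n.
  have h1 : `|y * (k%:R / k.+1%:R)| <= k%:R * e.
    rewrite normrM [`|_ / _|]ger0_norm ?divr_ge0// mulrA ler_pdivrMr//.
    by rewrite [leLHS]mulrC -mulrA ler_wpM2l// [leRHS]mulrC.
  have h2 : `|y - y * (k%:R / k.+1%:R)| <= e.
    have -> : y - y * (k%:R / k.+1%:R) = y / k.+1%:R.
      by rewrite -natr1 in k0 *; field; rewrite gt_eqF.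
    by rewrite normrM [`|_^-1|]ger0_norm ?invr_ge0// ler_pdivrMr// mulrC.
  have := step _ _ h2; have := IH _ h1; set z := y * _ => fz fyz.
  rewrite -[f y](subrK (f z)) (le_trans (ler_normD _ _))// -natr1.
  by lra.
exists e^-1; first by rewrite invr_ge0 ltW.
(* Rounding |y| / e up to an integer costs the extra 1 in the constant term. *)
move=> y; have := truncn_itv (x := `|y| / e).
rewrite divr_ge0 ?(ltW e0)// => /(_ isT)/andP[ky yk].
apply: le_trans (bound (Num.trunc (`|y| / e)).+1 y _) _.
  by rewrite -ler_pdivrMr// ltW.
by rewrite -natr1 [e^-1 * _]mulrC; lra.
Qed.

Lemma unif_continuous_continuous (R : realType) (f : R -> R) :
  unif_continuous f -> continuous f.
Proof.
move=> /unif_continuousP uf x; apply/cvgrPdist_lt => e e0.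
have [d d0 fd] := uf e e0; near=> t.
apply: (fd (x, t)); rewrite /ball/=.
by near: t; exact: cvgr_dist_lt.
Unshelve. all: by end_near. Qed.

(** * Contraction of the modulus and preservation of uniform continuity *)

Theorem theorem5 (R : realType) (q beta : R) (n : nat)
    (q_gt0 : 0 < q) (beta_gt0 : 0 < beta) (n_gt0 : (0 < n)%N) :
  (forall f : R -> R, (C_B R `|` C_U R) f ->
     forall theta : R, 0 < theta ->
       (omega (B q beta n f) theta <= omega f theta)%E) /\
  (forall f : R -> R, C_U R f -> C_U R (B q beta n f)).
Proof.
split=> [f fBU theta theta0|f fU].
  have [a [c [a0 c0 cf fac]]] : exists a c,
      [/\ 0 <= a, 0 <= c, continuous f & forall y, `|f y| <= a + c * `|y|].
    case: fBU => [[cf [M [_ fM]]]|fU].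
      (* [bounded_fun] gives a bound for every number strictly above [M], hence M + 1; the absolute
         value makes it nonnegative. *)
      exists `|M + 1|, 0; split => // y; rewrite mul0r addr0.
      by apply: le_trans (ler_norm _); apply: fM => //; rewrite ltrDl.
    have [c c0 fc] := unif_continuous_linear_growth fU.
    by exists (`|f 0| + 1), c; split => //; exact: unif_continuous_continuous.
  have fw x y : `|x - y| <= theta -> (`|f x - f y|%:E <= omega f theta)%E.
    by move=> xy; apply: ereal_sup_ubound; exists (x, y).
  (* The value +oo is trivial, and -oo is excluded because the pair (0, 0) contributes a real
     number. *)
  case ew : (omega f theta) fw => [w| |] fw; last 2 first.
  - by rewrite leey.
  - have := fw 0 0; rewrite subrr normr0 => /(_ (ltW theta0)).
    by rewrite leeNy_eq.
  apply: ge_ereal_sup => _ [[x y] /= xy <-]; rewrite lee_fin.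
  apply: (B_oscillation_le q_gt0 beta_gt0 n_gt0 cf a0 c0 fac _ xy).
  by move=> u v uv; rewrite -lee_fin fw.
have [c c0 fc] := unif_continuous_linear_growth fU.
apply/unif_continuousP => e e0.
(* Uniform continuity uses strict inequalities and [B_oscillation_le] non-strict ones; halving [e]
   and [d] bridges the two. *)
have e20 : 0 < e / 2 by rewrite divr_gt0.
have [d d0 fd] := (unif_continuousP _).1 fU _ e20.
exists (d / 2); first by rewrite divr_gt0.
move=> [x y] /= xy; apply: (@le_lt_trans _ _ (e / 2)); last by lra.
apply: (B_oscillation_le (theta := d / 2) q_gt0 beta_gt0 n_gt0
  (unif_continuous_continuous fU) _ c0 fc) => //.
- by move=> u v uv; apply/ltW/(fd (u, v)) => /=; rewrite /ball/=; lra.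
- exact: ltW.
Qed.
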